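(* Let $n\ge 2$, let $l_\infty$ be a line of $\mathrm{PG}(2,q^n)$, and let $\varphi$ be the associated André-Bruck-Bose map. Let $B$ be a $q$-subplane of $\mathrm{PG}(2,q^n)$ that is tangent to $l_\infty$ at the point $T$. Let $b$ be a line of $B$ not through $T$, $\Theta=\langle b\rangle_{q^n}\cap l_\infty$, and $\delta=\min\{q,[\Theta:b]\}$. Then there are a normal rational curve $\mathcal{C}_0$ of order $\delta$ in the $n$-dimensional subspace $\varphi(\langle b\rangle_{q^n}\setminus l_\infty)$, a normal rational curve $\mathcal{C}_1\subset\mathcal{F}(T)$ of order $\delta'$, with $$\delta'\ \begin{cases}=[\Theta:b]-1&\text{for }q>[\Theta:b],\\ \in\{q-1,q\}&\text{otherwise,}\end{cases}$$ and a projectivity $\kappa:\mathcal{C}_0\rightarrow\mathcal{C}_1$, such that $\varphi(B\setminus l_\infty)$ is the ruled surface that is the union of all affine lines $XX^\kappa$ (the lines joining $X$ and $X^\kappa$, minus the point at infinity $X^\kappa$) for $X\in\mathcal{C}_0$.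
   Context: All dimensions are projective. Field reduction $\mathcal{F}$: identify $\mathrm{PG}(3n-1,q)$ with the projective space of the $\mathbb{F}_q$-vector space $\mathbb{F}_{q^n}^3$; for a point $P=\langle v\rangle_{\mathbb{F}_{q^n}}$ of $\mathrm{PG}(2,q^n)$, $\mathcal{F}(P)$ is the $(n-1)$-dimensional subspace $\{\langle\lambda v\rangle_{\mathbb{F}_q}:\lambda\in\mathbb{F}_{q^n}^*\}$ of $\mathrm{PG}(3n-1,q)$; for a point set $S$, $\mathcal{F}(S)=\{\mathcal{F}(P):P\in S\}$. André-Bruck-Bose map: let $\mathcal{K}$ be a $2n$-dimensional subspace of $\mathrm{PG}(3n-1,q)$ containing $\mathcal{F}(l_\infty)$, so that $\langle\mathcal{F}(l_\infty)\rangle_q$ is a $(2n-1)$-dimensional hyperplane of $\mathcal{K}$ (the hyperplane at infinity). Take $\mathrm{AG}(2,q^n)=\mathrm{PG}(2,q^n)\setminus l_\infty$ and $\mathrm{AG}(2n,q)=\mathcal{K}\setminus\langle\mathcal{F}(l_\infty)\rangle_q$. The map $\varphi:\mathrm{AG}(2,q^n)\to\mathrm{AG}(2n,q)$, $\varphi(X)=\mathcal{F}(X)\cap\mathcal{K}$, is a bijection, mapping lines of $\mathrm{AG}(2,q^n)$ to $n$-dimensional subspaces of $\mathrm{AG}(2n,q)$ whose $(n-1)$-dimensional subspaces at infinity belong to $\mathcal{F}(l_\infty)$. A $q$-subplane of $\mathrm{PG}(2,q^n)$ is a set of points $\{\langle xu+yv+zw\rangle_{\mathbb{F}_{q^n}}:(x,y,z)\in\mathbb{F}_q^3\setminus\{0\}\}$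 with $u,v,w$ linearly independent over $\mathbb{F}_{q^n}$, with its structure of projective plane of order $q$; its lines are $q$-sublines, i.e. sets of $q+1$ points of the form $\{\langle xu+yv\rangle_{\mathbb{F}_{q^n}}:(x,y)\in\mathbb{F}_q^2\setminus\{(0,0)\}\}$ with $u,v$ independent over $\mathbb{F}_{q^n}$. $B$ is tangent to $l_\infty$ at $T$ if $B\cap l_\infty=\{T\}$. $\langle b\rangle_{q^n}$ is the line of $\mathrm{PG}(2,q^n)$ containing $b$. For a point $\Theta\in\langle b\rangle_{q^n}$: if $\Theta\in b$ then $[\Theta:b]=1$; otherwise $[\Theta:b]=[\mathbb{F}_q(\zeta):\mathbb{F}_q]$, where $(1,\zeta)$ are homogeneous coordinates of $\Theta$ on $\langle b\rangle_{q^n}$ with respect to a reference frame of three points of $b$ (receiving coordinates $(1,0),(0,1),(1,1)$); this does not depend on the frame. A normal rational curve of order $t$ is a set of points spanning a $t$-dimensional subspace and equal, in suitable homogeneous coordinates of that subspace, to $\{\langle(y_0^t,y_0^{t-1}y_1,\ldots,y_1^t)\rangle:(y_0,y_1)\in\mathbb{F}_q^2\setminus\{(0,0)\}\}$ (order $1$: a line; order $q$: a set of $q+1$ independent points); such a representation is a parametrization of the curve by $\mathrm{PG}(1,q)$. A bijection between two normal rational curves (possibly of different orders) is called a projectivity if, for suitable such parametrizations of the two curves, it corresponds to a projectivity between the parametrizing projective lines $\mathrm{PG}(1,q)$. *)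

(* Defs.v *)
From HB Require Import structures.
From mathcomp Require Import all_boot all_order all_algebra all_field.
From mathcomp Require Import boolp classical_sets functions.

Set Implicit Arguments.
Unset Strict Implicit.
Unset Printing Implicit Defensive.

Import GRing.Theory.
Local Open Scope ring_scope.
Local Open Scope classical_set_scope.

(* A projective subspace is given by its underlying vector subspace, so a     *)
(* subspace of projective dimension d is a vspace of dimension d + 1.         *)

Section Projective.

Variables (K : fieldType) (V : vectType K).

Definition point_set (U : {vspace V}) : set {vspace V} :=
  [set P | \dim P = 1%N /\ (P <= U)%VS].

(* U is the smallest subspace containing every member of S *)
Definition spans (S : set {vspace V}) (U : {vspace V}) : Prop :=
  forall W : {vspace V}, (U <= W)%VS <-> (forall P, S P -> (P <= W)%VS).

(* (y_0^t, y_0^(t-1) y_1, ..., y_1^t) in the homogeneous coordinates given by *)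
(* the vectors e                                                              *)
Definition nrc_point (t : nat) (e : t.+1.-tuple V) (y : 'rV[K]_2) :
    {vspace V} :=
  <[\sum_(i < t.+1) (y 0 0 ^+ (t - i) * y 0 1 ^+ i) *: tnth e i]>%VS.

Definition nrc_parametrization (t : nat) (C : set {vspace V})
    (e : t.+1.-tuple V) : Prop :=
  exists U : {vspace V},
    [/\ spans C U, basis_of U e & C = nrc_point e @` [set y | y != 0]].

Definition normal_rational_curve (t : nat) (C : set {vspace V}) : Prop :=
  exists e : t.+1.-tuple V, nrc_parametrization C e.

Definition nrc_projectivity (s t : nat) (C D : set {vspace V})
    (k : {vspace V} -> {vspace V}) : Prop :=
  set_bij C D k /\
  exists (c : s.+1.-tuple V) (d : t.+1.-tuple V) (M : 'M[K]_2),
    [/\ nrc_parametrization C c, nrc_parametrization D d, M \in unitmx &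
        forall y : 'rV[K]_2, y != 0 ->
          k (nrc_point c y) = nrc_point d (y *m M)].

(* Union over X in C of the lines joining X and k X, each deprived of k X *)
Definition ruled_surface (C : set {vspace V}) (k : {vspace V} -> {vspace V}) :
    set {vspace V} :=
  \bigcup_(X in C) (point_set (X + k X)%VS `\ k X).

End Projective.

(* F has order q and L is its extension of degree n: PG(2, q^n) is the        *)
(* projective space of 'rV[L]_3, and PG(3n - 1, q) that of L^3 over F, namely *)
(* of {ffun 'I_3 -> L} ('rV[L]_3 itself only carries the L-linear structure). *)

Section FieldReduction.

Variables (F : finFieldType) (L : fieldExtType F).

(* If P = <v>, the F-subspace of the vectors l * v for l in L *)
Definition field_reduction (P : {vspace 'rV[L]_3}) : {vspace {ffun 'I_3 -> L}} :=
  limg (linfun (fun l : L => [ffun i => l * vpick P 0 i])).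

Definition andre_bruck_bose (K : {vspace {ffun 'I_3 -> L}})
    (P : {vspace 'rV[L]_3}) : {vspace {ffun 'I_3 -> L}} :=
  (field_reduction P :&: K)%VS.

Definition subplane (B : set {vspace 'rV[L]_3}) : Prop :=
  exists u v w : 'rV[L]_3, free [:: u; v; w] /\
    B = [set P | exists x y z : F, (x, y, z) != (0, 0, 0) /\
                   P = <[x%:A *: u + y%:A *: v + z%:A *: w]>%VS].

Definition subline (b : set {vspace 'rV[L]_3}) : Prop :=
  exists u v : 'rV[L]_3, free [:: u; v] /\
    b = [set P | exists x y : F, (x, y) != (0, 0) /\
                   P = <[x%:A *: u + y%:A *: v]>%VS].

Definition subplane_line (B b : set {vspace 'rV[L]_3}) : Prop :=
  subline b /\ b `<=` B.

Definition tangent_at (B : set {vspace 'rV[L]_3}) (l T : {vspace 'rV[L]_3}) :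
    Prop :=
  B `&` point_set l = [set T].

(* The value of point_degree at a point of <b> outside b: u, v, u + v         *)
(* represent the points of a frame of b, for which Q has coordinates (1, z).  *)
Definition frame_degree (b : set {vspace 'rV[L]_3}) (Q : {vspace 'rV[L]_3}) :
    set nat :=
  [set d | exists (u v : 'rV[L]_3) (z : L),
     [/\ free [:: u; v],
         [/\ b <[u]>%VS, b <[v]>%VS & b <[u + v]>%VS],
         Q = <[u + z *: v]>%VS & d = \dim <<1; z>>%VS]].

(* [Q : b]; frame_degree b Q is a singleton when Q is a point of <b> not in b *)
Definition point_degree (b : set {vspace 'rV[L]_3}) (Q : {vspace 'rV[L]_3}) :
    nat :=
  if `[< b Q >] then 1%N else xget 0%N (frame_degree b Q).

End FieldReduction.

(* Main.v *)
Require Import Defs.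
From HB Require Import structures.
From mathcomp Require Import all_boot all_order all_algebra all_field.
From mathcomp Require Import boolp classical_sets functions.
From mathcomp Require Import ring.

Import GRing.Theory.
Local Open Scope ring_scope.
Local Open Scope classical_set_scope.
Set Implicit Arguments.
Unset Strict Implicit.
Unset Printing Implicit Defensive.

(** Why the theorem holds. Let q be the order of F. Two independent vectors of
    lb that represent points of b, a suitable representative t of T and a
    common rescaling give vectors a, h, t and a scalar z in L such that
    - a represents a point of lb not at infinity and lies in K, h spans Theta,
      and t spans T;
    - B consists of the points < (y0 - y1 z) a + y1 h + s t >, with y0, y1, s
      in F not all zero;
    - z is not in F, and m = [Theta : b] is the degree of z over F
    (adapted_frame, ambient_affine_chart). Since K is the set of vectors
    l a + v with l in F and v at infinity, the map phi divides such a vector by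
    its coefficient y0 - y1 z (andre_bruck_bose_affine), so that

      phi of the point (y, s) = < X_y + s Y_y >, where
      X_y = a + y1 / (y0 - y1 z) h   and   Y_y = t / (y0 - y1 z).

    For fixed y these are the points other than <Y_y> of the line joining <X_y>
    and <Y_y>. The ruled surface is therefore already there, with C0 the set
    of all <X_y>, C1 the set of all <Y_y> and kappa the map that keeps y.

    It remains to see that y parametrizes C0 and C1 as normal rational curves
    of the right orders. Up to a nonzero factor in F, depending on y, the
    function 1 / (y0 - y1 z) is a form in y with coefficients in L; on the
    parameters y = (s, 1) it becomes a polynomial g such that g(s) (s - z) is
    a nonzero element p(s) of F.
    - If m <= q, take for p the minimal polynomial of z and for g its quotient
      by X - z. This gives C1 order m - 1, and C0 order m because the multiple
      p a + g h of X has degree m (small_degree_forms).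
    - If q < m, the degree can be kept at most q because x^q = x on F: the
      interpolation polynomial g of 1 / (s - z) on F has degree less than q.
      Taking p = X^q - X + 1 makes p a + g h of degree q with leading
      coefficient a, the value at y = (1, 0); likewise g + X^q - X has leading
      coefficient 1, and both curves have order q (large_degree_forms).

    A form of degree t <= q describes a normal rational curve of order t as
    soon as its coefficients are independent over F, because Lagrange
    interpolation recovers them from the values
    (nrc_tuple_parametrization). The coefficients above are independent because
    their span contains, up to a common factor, the powers of z. *)

(** * Lines and scalars *)

Section Lines.

Variables (K : fieldType) (V : vectType K).

Lemma line_scale (a : K) (v : V) :
  a != 0 -> (<[a *: v]> = <[v]>)%VS.
Proof.
move=> a0; apply/eqP; rewrite eqEsubv -!memvE; apply/andP; split.
  by rewrite memvZ ?memv_line.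
by apply/vlineP; exists a^-1; rewrite scalerA mulVf ?scale1r.
Qed.

Lemma free2P (u v : V) (l l' : K) :
  free [:: u; v] -> l *: u + l' *: v = 0 -> l = 0 /\ l' = 0.
Proof.
move=> /(@freeP _ _ _ [tuple u; v]) f e.
pose k (i : 'I_2) := if i == 0 then l else l'.
have k0 := f k; rewrite !big_ord_recl big_ord0 addr0 /= in k0.
by split; [apply: (k0 e 0) | apply: (k0 e 1)].
Qed.

Lemma line_coordinates (l : {vspace V}) (u v : V) : \dim l = 2%N ->
  free [:: u; v] -> u \in l -> v \in l ->
  forall w, w \in l -> exists x y, w = x *: u + y *: v.
Proof.
move=> dl fuv ul vl w; suff -> : l = (<[u]> + <[v]>)%VS.
  by move=> /memv_addP[_ /vlineP[x ->] [_ /vlineP[y ->] ->]]; exists x, y.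
apply/eqP; rewrite eq_sym eqEdim subv_add -!memvE ul vl dl /=.
by rewrite -(span_seq1 v) -span_cons (eqP fuv).
Qed.

Lemma line_basis (l : {vspace V}) : \dim l = 2%N ->
  exists u v, [/\ u \in l, v \in l & free [:: u; v]].
Proof.
move=> dl; have [X] : exists X : 2.-tuple V, basis_of l X.
  by rewrite -dl; exists (vbasis l); apply: vbasisP.
case/tupleP: X => u X; case/tupleP: X => v X; rewrite (tuple0 X) => bl.
by exists u, v; rewrite !(basis_mem bl) ?inE ?eqxx ?orbT ?(basis_free bl).
Qed.

End Lines.

Section Scalars.

Variables (F : fieldType) (L : fieldExtType F).

Lemma alg_eq0 (a : F) : (a%:A == 0 :> L) = (a == 0).
Proof. by rewrite scaler_eq0 oner_eq0 orbF. Qed.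

Lemma algM (x y : F) : (x * y)%:A = x%:A * y%:A :> L.
Proof. exact: (rmorphM (in_alg L)). Qed.

End Scalars.

Arguments algM {F L}.

Lemma factor_through (I : choiceType) (S T : Type) (i0 : I) (P : set I)
    (f : I -> S) (g : I -> T) :
  (forall i j, P i -> P j -> f i = f j -> g i = g j) ->
  exists k, forall i, P i -> k (f i) = g i.
Proof.
move=> fg; exists (fun x => g (xget i0 [set i | P i /\ f i = x])) => i Pi.
by case: xgetP => [j _ [Pj /fg]|/(_ i)[]//]; apply.
Qed.

(** * Lagrange interpolation over a finite field *)

Section Lagrange.

Variable F : finFieldType.
Local Notation q := #|F|.

(** Over a field of order q the Lagrange basis polynomial of s at the set of
    all field elements has this closed form, since x^(q-1) = 1 for x != 0. *)
Definition lagrange (s : F) : {poly F} := 1 - ('X - s%:P) ^+ q.-1.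

Lemma card_field_gt1 : (1 < q)%N.
Proof. exact: finNzRing_gt1. Qed.

Lemma horner_lagrange (s r : F) : (lagrange s).[r] = (r == s)%:R.
Proof.
rewrite /lagrange !hornerE; case: eqP => [->|/eqP rs].
  by rewrite subrr expr0n eqn0Ngt -subn1 subn_gt0 card_field_gt1 subr0.
have d0 : r - s != 0 by rewrite subr_eq0.
apply/eqP; rewrite subr_eq0 eq_sym; apply/eqP/(mulfI d0).
by rewrite -exprS prednK ?mulr1 ?expf_card // ltnW // card_field_gt1.
Qed.

Lemma size_lagrange (s : F) : (size (lagrange s) <= q)%N.
Proof.
apply: leq_trans (size_polyD _ _) _; rewrite geq_max size_poly1 size_polyN.
have q0 : (0 < q)%N := ltnW card_field_gt1.
by rewrite size_exp_XsubC prednK // leqnn q0.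
Qed.

Lemma small_poly_eq0 (h : {poly F}) :
  (size h <= q)%N -> (forall s, h.[s] = 0) -> h = 0.
Proof.
move=> szh h0; apply/eqP; apply: contraT => hn0.
have: all (root h) (enum F) by apply/allP=> s _; apply/rootP.
by move=> /(max_poly_roots hn0) /(_ (enum_uniq _)); rewrite -cardE ltnNge szh.
Qed.

Lemma lagrange_interpolation (h : {poly F}) :
  (size h <= q)%N -> h = \sum_s h.[s] *: lagrange s.
Proof.
move=> szh; apply/eqP; rewrite -subr_eq0; apply/eqP/small_poly_eq0.
  apply: leq_trans (size_polyD _ _) _; rewrite geq_max szh size_polyN.
  apply: leq_trans (size_sum _ _ _) _; apply/bigmax_leqP => s _.
  exact: leq_trans (size_scale_leq _ _) (size_lagrange s).
move=> r; rewrite hornerD hornerN horner_sum (bigD1 r) //= big1 ?addr0.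
  by rewrite !hornerZ horner_lagrange eqxx mulr1 subrr.
by move=> s sr; rewrite hornerZ horner_lagrange eq_sym (negPf sr) mulr0.
Qed.

(** A vector-valued polynomial of degree less than k <= q is determined by its
    values on F, and its coefficients are F-combinations of these values. *)
Lemma coef_interpolation (V : lmodType F) (E : nat -> V) (k j : nat) :
  (k <= q)%N -> (j < k)%N ->
  E j = \sum_s (lagrange s)`_j *: \sum_(i < k) s ^+ i *: E i.
Proof.
move=> kq jk; under eq_bigr do rewrite scaler_sumr.
have coefE i : (i < k)%N -> \sum_s (lagrange s)`_j * s ^+ i = (j == i)%:R.
  move=> ik; rewrite -coefXn.
  rewrite [X in _ = X`_j](congr1 polyseq (@lagrange_interpolation 'X^i _)).
    by rewrite coef_sum; apply: eq_bigr => s _; rewrite coefZ hornerXn mulrC.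
  by rewrite size_polyXn (leq_trans ik).
rewrite exchange_big /= (bigD1 (Ordinal jk)) //= [X in _ + X]big1 ?addr0.
  under eq_bigr do rewrite scalerA.
  by rewrite -scaler_suml coefE // eqxx scale1r.
move=> i ij; under eq_bigr do rewrite scalerA.
rewrite -scaler_suml coefE // eq_sym -[j]/(val (Ordinal jk)) val_eqE.
by rewrite (negPf ij) scale0r.
Qed.

End Lagrange.
(** * Normal rational curves *)

Section NormalRationalCurves.

Variables (F : finFieldType) (V : vectType F).
Local Notation q := #|F|.

Definition param (x y : F) : 'rV[F]_2 := \row_j (if j == 0 then x else y).

Lemma paramE (x y : F) : (param x y 0 0 = x) * (param x y 0 1 = y).
Proof. by rewrite !mxE. Qed.

Lemma row2_eqP (y y' : 'rV[F]_2) : y 0 0 = y' 0 0 -> y 0 1 = y' 0 1 -> y = y'.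
Proof.
move=> e0 e1; apply/rowP => j; case: (fintype.unliftP 0 j) => [k|] -> //.
by rewrite (_ : lift 0 k = 1) //; apply/val_inj; rewrite /= ord1.
Qed.

(** Together with nrc_pointZ, this reduces every statement on points of a
    parametrized curve to polynomial values and to a leading coefficient. *)
Lemma param_normal_form (y : 'rV[F]_2) : y != 0 ->
  exists2 a : F, a != 0 & y = a *: param 1 0 \/ exists s, y = a *: param s 1.
Proof.
move=> yn0; have [y1|y1] := eqVneq (y 0 1) 0.
  exists (y 0 0); last by left; apply: row2_eqP; rewrite !mxE /= ?mulr1 ?mulr0.
  apply: contra yn0 => /eqP y0; apply/eqP; apply: row2_eqP; rewrite mxE //.
exists (y 0 1) => //; right; exists (y 0 0 / y 0 1).
by apply: row2_eqP; rewrite !mxE /= ?mulr1 // mulrC divfK.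
Qed.

Lemma param10_neq0 : param 1 0 != 0.
Proof.
by apply/eqP => /rowP/(_ 0); rewrite !mxE /= => /eqP; rewrite oner_eq0.
Qed.

Lemma params1_neq0 (s : F) : param s 1 != 0.
Proof.
by apply/eqP => /rowP/(_ 1); rewrite !mxE /= => /eqP; rewrite oner_eq0.
Qed.

(** The homogeneous form of degree t whose dehomogenization at y1 = 1 is the
    polynomial with coefficients E 0, ..., E t; the exponent of y0 decreases
    along the tuple of a parametrization, which reverses the order. *)
Definition nrc_tuple (t : nat) (E : nat -> V) : t.+1.-tuple V :=
  [tuple E (t - i)%N | i < t.+1].

Lemma nrc_pointZ (t : nat) (e : t.+1.-tuple V) (a : F) (y : 'rV[F]_2) :
  a != 0 -> nrc_point e (a *: y) = nrc_point e y.
Proof.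
move=> a0; rewrite /nrc_point -[RHS](@line_scale _ _ (a ^+ t)) ?expf_neq0 //.
congr (<[_]>)%VS; rewrite scaler_sumr; apply: eq_bigr => i _.
rewrite !mxE !exprMn scalerA mulrACA -exprD subnK //.
by rewrite -ltnS.
Qed.

Lemma nrc_point_affine (t : nat) (E : nat -> V) (s : F) :
  nrc_point (nrc_tuple t E) (param s 1) = <[\sum_(j < t.+1) s ^+ j *: E j]>%VS.
Proof.
rewrite /nrc_point; congr (<[_]>)%VS.
rewrite [RHS](reindex_inj rev_ord_inj) /=; apply: eq_bigr => i _.
by rewrite !paramE expr1n mulr1 tnth_mktuple subSS.
Qed.

Lemma nrc_point_infinity (t : nat) (E : nat -> V) :
  nrc_point (nrc_tuple t E) (param 1 0) = <[E t]>%VS.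
Proof.
rewrite /nrc_point big_ord_recl big1 ?addr0; last first.
  by move=> i _; rewrite !paramE /= expr0n mulr0 scale0r.
by rewrite !paramE expr1n mulr1 scale1r tnth_mktuple subn0.
Qed.

Lemma nrc_tuple_rev (t : nat) (E : nat -> V) :
  nrc_tuple t E = rev (mkseq E t.+1) :> seq V.
Proof.
apply: (@eq_from_nth _ 0) => [|i]; rewrite size_tuple ?size_rev ?size_mkseq //.
move=> it; rewrite nth_rev ?size_mkseq // nth_mkseq ?subSS ?ltnS ?leq_subr //.
by rewrite -[i]/(val (Ordinal it)) -tnth_nth tnth_mktuple.
Qed.

Lemma free_mkseqP (k : nat) (E : nat -> V) :
  free (mkseq E k) <->
  forall c : nat -> F, \sum_(j < k) c j *: E j = 0 ->
    forall j, (j < k)%N -> c j = 0.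
Proof.
have sz : size (mkseq E k) == k by rewrite size_mkseq.
pose X := Tuple sz; have XE (i : 'I_k) : X`_i = E i by rewrite nth_mkseq.
split=> [/(@freeP _ _ _ X) fX c c0 j jk|fX].
  apply: (fX (fun i => c i) _ (Ordinal jk)).
  by under eq_bigr do rewrite XE.
apply/(@freeP _ _ _ X) => c c0 i.
pose c' j := if insub j is Some i' then c i' else 0.
have c'E (i' : 'I_k) : c' i' = c i' by rewrite /c' valK.
rewrite -c'E; apply: fX => //; rewrite -[RHS]c0.
by apply: eq_bigr => i' _; rewrite c'E XE.
Qed.

Lemma mem_span_mkseq (k : nat) (E : nat -> V) (j : nat) :
  (j < k)%N -> E j \in <<mkseq E k>>%VS.
Proof. by move=> jk; apply/memv_span/map_f; rewrite mem_iota. Qed.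

Lemma free_mkseq_sub (k : nat) (E D : nat -> V) :
  free (mkseq D k) -> (forall j, (j < k)%N -> D j \in <<mkseq E k>>%VS) ->
  free (mkseq E k).
Proof.
move=> fD DE; have DsE : (<<mkseq D k>> <= <<mkseq E k>>)%VS.
  by apply/span_subvP => v /mapP[j]; rewrite mem_iota => /= jk ->; apply: DE.
rewrite /free eqn_leq dim_span size_mkseq /=.
by rewrite -[X in (X <= _)%N](size_mkseq D) -(eqP fD) dimvS.
Qed.

(** The points span the space of all coefficients: a subspace W containing them
    contains the leading coefficient, hence the values of the remaining
    polynomial of degree less than t <= q, hence all its coefficients. *)
Lemma nrc_tuple_parametrization (t : nat) (E : nat -> V) :
  (t <= q)%N -> free (mkseq E t.+1) ->
  nrc_parametrization (nrc_point (nrc_tuple t E) @` [set y | y != 0])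
    (nrc_tuple t E).
Proof.
move=> tq fE; exists <<nrc_tuple t E>>%VS; split=> //; last first.
  by rewrite /basis_of eqxx nrc_tuple_rev (perm_free (permEl (perm_rev _))).
move=> W; split=> [eW _ [y _ <-]|CW].
  rewrite -memvE (subvP eW) //; apply: memv_suml => i _.
  by rewrite memvZ // memv_span // mem_tnth.
have EtW : E t \in W.
  by rewrite memvE -nrc_point_infinity; apply: CW; exists (param 1 0) => //=;
    exact: param10_neq0.
have EsW s : \sum_(j < t) s ^+ j *: E j \in W.
  have: \sum_(j < t.+1) s ^+ j *: E j \in W.
    rewrite memvE -nrc_point_affine; apply: CW; exists (param s 1) => //=.
    exact: params1_neq0.
  by rewrite big_ord_recr /= rpredDr // memvZ.
have EW j : (j < t.+1)%N -> E j \in W.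
  rewrite ltnS leq_eqVlt => /predU1P[->//|jt].
  by rewrite (coef_interpolation E tq jt) memv_suml // => s _; rewrite memvZ.
apply/span_subvP => v; rewrite nrc_tuple_rev mem_rev => /mapP[j].
by rewrite mem_iota => /= jt ->; apply: EW.
Qed.

End NormalRationalCurves.
(** * Forms representing 1 / (y0 - y1 z) *)

Section Reciprocals.

Variables (F : finFieldType) (L : fieldExtType F) (z : L).
Local Notation q := #|F|.
Local Notation m := (\dim <<1; z>>%VS).
Local Notation toL := (map_poly (in_alg L)).

Lemma degreeE : adjoin_degree 1%VS z = m.
Proof. by rewrite (dim_Fadjoin 1%AS) dimv1 muln1. Qed.

Lemma free_powers (k : nat) : (k <= m)%N -> free (mkseq (fun j => z ^+ j) k).
Proof.
move=> km; apply/free_mkseqP => c c0 j jk.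
pose P := \poly_(i < k) (c i)%:A : {poly L}.
have PO : P \is a polyOver 1%VS.
  by apply/polyOver_poly => i _; rewrite memvZ // memv_line.
have Pz : root P z.
  apply/rootP; rewrite horner_poly -[RHS]c0; apply: eq_bigr => i _.
  by rewrite -scalerAl mul1r.
have := minPoly_dvdp (K := 1%AS) PO Pz.
have [P0 _|Pn0 /(dvdp_leq Pn0)] := eqVneq P 0.
  have /eqP : P`_j = 0 by rewrite P0 coef0.
  by rewrite coef_poly jk alg_eq0 => /eqP.
by rewrite size_minPoly degreeE ltnNge (leq_trans (size_poly _ _) km).
Qed.

Hypothesis zF : z \notin 1%VS.

Lemma sub_alg_neq0 (s : F) : s%:A - z != 0.
Proof.
by apply: contra zF; rewrite subr_eq0 => /eqP <-; rewrite memvZ ?memv_line.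
Qed.

Lemma degree_gt1 : (1 < m)%N.
Proof.
have : adjoin_degree 1%AS z != 1%N by rewrite adjoin_deg_eq1.
by rewrite /= degreeE; have := adim_gt0 <<1%AS; z>>%AS; case: m => [|[]].
Qed.

Lemma horner_toL (p : {poly F}) (s : F) : (toL p).[s%:A] = p.[s]%:A.
Proof. exact: (horner_map (in_alg L)). Qed.

Lemma horner_sum_coef (h : {poly L}) (k : nat) (s : F) : (size h <= k)%N ->
  h.[s%:A] = \sum_(j < k) s ^+ j *: h`_j.
Proof.
move=> szh; rewrite (horner_coef_wide _ szh); apply: eq_bigr => j _.
by rewrite -(rmorphXn (in_alg L)) /= mulrC -scalerAl mul1r.
Qed.

(** With p the minimal polynomial of z and g = p / (X - z): p has no root s in
    F, as it would be divisible by X - s. The span of the coefficients of g is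
    F(z), so the m coefficients are independent. *)
Lemma small_degree_forms : exists (p : {poly F}) (g : {poly L}),
  [/\ size p = m.+1, forall s, p.[s] != 0,
      forall s, g.[s%:A] * (s%:A - z) = p.[s]%:A,
      (size g <= m)%N & g`_m.-1 = 1 /\ free (mkseq (nth 0%R g) m)].
Proof.
have /polyOver1P[p pE] := minPolyOver 1%AS z.
pose g := minPoly 1%VS z %/ ('X - z%:P).
have gE : g * ('X - z%:P) = minPoly 1%VS z.
  by apply: divpK; rewrite dvdp_XsubCl root_minPoly.
have gn0 : g != 0.
  apply: contra (monic_neq0 (monic_minPoly 1 z)) => /eqP g0.
  by rewrite -gE g0 mul0r.
have szg : size g = m.
  have := size_minPoly 1 z; rewrite -gE degreeE size_Mmonic ?monicXsubC //.
  by rewrite size_XsubC addn2 => -[].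
have szp : size p = m.+1.
  by rewrite -degreeE -size_minPoly pE size_map_poly.
have m1 := degree_gt1.
have coefg j : g`_j = (p`_j.+1)%:A + z * g`_j.+1.
  have := congr1 (fun P : {poly L} => P`_j.+1) gE.
  by rewrite pE coef_map /= mulrBr coefB coefMX coefMC /= => <-; ring.
have coefg0 : z * g`_0 = - (p`_0)%:A.
  have := congr1 (fun P : {poly L} => P`_0) gE.
  by rewrite pE coef_map /= mulrBr coefB coefMX coefMC /= => <-; ring.
have glead : g`_m.-1 = 1.
  have /monicP := monic_minPoly 1 z.
  by rewrite -gE lead_coef_Mmonic ?monicXsubC // lead_coefE szg.
exists p, g; split=> // [s|s||].
- rewrite -(alg_eq0 L) -horner_toL -pE; apply/negP => /eqP/rootP.
  rewrite -dvdp_XsubCl => /(minPoly_irr (K := 1%AS)).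
  rewrite polyOverXsubC memvZ ?memv_line // => /(_ isT) /orP[] /eqp_size.
    rewrite size_XsubC size_minPoly degreeE => -[m1']; by rewrite -m1' in m1.
  by rewrite size_XsubC size_poly1.
- by rewrite -horner_toL -pE -gE hornerM hornerXsubC.
- by rewrite szg.
split=> //.
have X1 : 1 \in <<mkseq (nth 0%R g) m>>%VS.
  have := @mem_span_mkseq _ _ m (nth 0%R g) m.-1; rewrite glead; apply.
  by rewrite prednK // ltnW.
(* g_(j-1) = p_j + z g_j, so the span of the coefficients, which contains 1, *)
(* is stable under multiplication by z                                       *)
have Xz w : w \in <<mkseq (nth 0%R g) m>>%VS ->
    z * w \in <<mkseq (nth 0%R g) m>>%VS.
  have sz : size (mkseq (nth 0%R g) m) == m by rewrite size_mkseq.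
  move=> /(@coord_span _ _ _ (Tuple sz)) ->.
  rewrite mulr_sumr memv_suml // => i _.
  rewrite -scalerAr memvZ // nth_mkseq //.
  case: {+}(i : nat) (ltn_ord i) => [|j] jm.
    by rewrite coefg0 memvN memvZ.
  have -> : z * g`_j.+1 = g`_j - (p`_j.+1)%:A by rewrite (coefg j); ring.
  by rewrite memvB ?memvZ // mem_span_mkseq // ltnW.
apply: (free_mkseq_sub (free_powers (leqnn m))) => j _.
by elim: j => [|j IH]; rewrite ?expr0 // exprS Xz.
Qed.

(** This is the identity (X - s)^q = X^q - s, obtained here by comparing values
    on F. *)
Lemma XsubC_lagrange (s : F) : ('X - s%:P) * lagrange s = 'X - 'X^q.
Proof.
have q0 : (0 < q)%N := ltnW (card_field_gt1 F).
apply/eqP; rewrite -subr_eq0; apply/eqP/small_poly_eq0; last first.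
  move=> r; rewrite hornerD hornerN hornerM horner_lagrange !hornerE expf_card.
  rewrite subrr subr0; have [->|_] := eqVneq r s; last by rewrite mulr0.
  by rewrite subrr mul0r.
rewrite /lagrange mulrBr mulr1 -exprS prednK //.
have -> : 'X - s%:P - ('X - s%:P) ^+ q - ('X - 'X^q)
  = 'X^q - ('X - s%:P) ^+ q - s%:P by ring.
apply: leq_trans (size_polyD _ _) _; rewrite geq_max size_polyN.
rewrite (leq_trans (size_polyC_leq1 _)) // andbT.
apply/leq_sizeP => j; rewrite leq_eqVlt => /predU1P[<-|qj].
  rewrite coefB coefXn eqxx; have /monicP := monic_exp q (monicXsubC s).
  by rewrite lead_coefE size_exp_XsubC => ->; rewrite subrr.
by rewrite coefB !nth_default ?subr0 // ?size_exp_XsubC ?size_polyXn.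
Qed.

Lemma frobenius_sub_neq0 : z ^+ q - z != 0.
Proof.
have /(congr1 (fun P => (toL P).[z])) := finField_genPoly F.
rewrite rmorphB rmorph_prod /= map_polyXn map_polyX !hornerE horner_prod => ->.
apply/prodf_neq0 => s _; rewrite map_polyXsubC hornerXsubC /=.
by rewrite -opprB oppr_eq0 sub_alg_neq0.
Qed.

(** Evaluating the Lagrange basis at z gives multiples of 1 / (s - z) by
    z^q - z, independent of s; interpolating X^j and evaluating at z writes z^j
    as an F-combination of these. *)
Lemma scaled_powers_in_span (S : {vspace L}) (j : nat) :
  (forall s : F, (s%:A - z)^-1 \in S) -> (j < q)%N ->
  (z ^+ q - z)^-1 * z ^+ j \in S.
Proof.
move=> Ss jq; have lagz s :
    (toL (lagrange s)).[z] = (z ^+ q - z) / (s%:A - z).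
  have /(congr1 (fun P => (toL P).[z])) := XsubC_lagrange s.
  rewrite rmorphM /= map_polyXsubC [toL ('X - 'X^q)]rmorphB /=.
  rewrite map_polyXn map_polyX.
  rewrite hornerM hornerXsubC !hornerE /= => e.
  apply: (mulIf (sub_alg_neq0 s)); rewrite divfK ?sub_alg_neq0 //.
  by rewrite mulrC -opprB mulNr e opprB.
have := @lagrange_interpolation F 'X^j; rewrite size_polyXn => /(_ jq).
move=> /(congr1 (fun P => (toL P).[z])).
rewrite map_polyXn hornerXn rmorph_sum horner_sum /= => ->.
rewrite mulr_sumr memv_suml // => s _; rewrite map_polyZ hornerZ lagz.
rewrite mulrCA mulKf ?frobenius_sub_neq0 // mulrC -scalerAr mulr1.
by rewrite memvZ.
Qed.

Lemma free_scaled_powers (k : nat) : (k <= m)%N ->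
  free (mkseq (fun j => (z ^+ q - z)^-1 * z ^+ j) k).
Proof.
move=> /free_powers /free_mkseqP fz; apply/free_mkseqP => c c0; apply: fz.
apply: (mulfI (invr_neq0 frobenius_sub_neq0)); rewrite mulr0 mulr_sumr -[RHS]c0.
by apply: eq_bigr => j _; rewrite scalerAr.
Qed.

(** When z has degree larger than q, the q values 1 / (s - z) are independent,
    and stay so when 1 is added: their span contains 1, ..., z^q divided by
    z^q - z. Both polynomials below take these values on F; adding X^q - X
    does not change them, but makes 1 the leading coefficient. *)
Lemma large_degree_forms : (q < m)%N -> exists g : {poly L},
  [/\ forall s, g.[s%:A] * (s%:A - z) = 1, (size g <= q)%N,
      free (mkseq (nth 0%R g) q)
    & free (mkseq (nth 0%R (g + ('X^q - 'X))) q.+1)].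
Proof.
move=> qm; have q1 := card_field_gt1 F.
pose g := \sum_s (s%:A - z)^-1 *: toL (lagrange s).
have gE s : g.[s%:A] = (s%:A - z)^-1.
  rewrite horner_sum (bigD1 s) //= big1 ?addr0.
    by rewrite hornerZ horner_toL horner_lagrange eqxx scale1r mulr1.
  move=> r rs; rewrite hornerZ horner_toL horner_lagrange eq_sym (negPf rs).
  by rewrite scale0r mulr0.
have szg : (size g <= q)%N.
  apply: leq_trans (size_sum _ _ _) _; apply/bigmax_leqP => s _.
  by rewrite (leq_trans (size_scale_leq _ _)) // size_map_poly size_lagrange.
pose h := g + ('X^q - 'X).
have hE s : h.[s%:A] = (s%:A - z)^-1.
  rewrite hornerD gE !hornerE -(rmorphXn (in_alg L)) /= expf_card.
  by rewrite addrK.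
have szh : (size h <= q.+1)%N.
  apply: leq_trans (size_polyD _ _) _; rewrite geq_max (leq_trans szg) //=.
  by rewrite size_polyDl ?size_polyXn // size_polyN size_polyX.
have hq : h`_q = 1.
  rewrite coefD coefB coefXn coefX eqxx nth_default // add0r.
  by rewrite gtn_eqF // subr0.
have span_inv (P : {poly L}) k : (size P <= k)%N ->
    (forall s, P.[s%:A] = (s%:A - z)^-1) ->
    forall s : F, (s%:A - z)^-1 \in <<mkseq (nth 0%R P) k>>%VS.
  move=> szP PE s; rewrite -PE (horner_sum_coef _ szP) memv_suml // => j _.
  by rewrite memvZ // mem_span_mkseq.
exists g; split=> // [s||].
- by rewrite gE mulVf ?sub_alg_neq0.
- apply: (free_mkseq_sub (free_scaled_powers (ltnW qm))) => j.
  exact/scaled_powers_in_span/span_inv.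
apply: (free_mkseq_sub (free_scaled_powers qm)) => j.
rewrite ltnS leq_eqVlt => /predU1P[->|]; last first.
  exact/scaled_powers_in_span/span_inv.
have -> : (z ^+ q - z)^-1 * z ^+ q = 1 + (z ^+ q - z)^-1 * z ^+ 1.
  by rewrite -[X in _ * X](subrK z) mulrDr mulVf ?frobenius_sub_neq0.
rewrite memvD //; last exact/scaled_powers_in_span/q1/span_inv.
by rewrite -hq mem_span_mkseq.
Qed.

End Reciprocals.
(** * Field reduction in coordinates *)

Section FieldReductionCoordinates.

Variables (F : finFieldType) (L : fieldExtType F).
Local Notation V := 'rV[L]_3.
Local Notation W := {ffun 'I_3 -> L}.

(** The vector v, seen in the carrier that has an F-linear structure. *)
Definition flat (v : V) : W := [ffun i => v 0 i].

Lemma flatD (v w : V) : flat (v + w) = flat v + flat w.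
Proof. by apply/ffunP => i; rewrite !ffunE mxE. Qed.

Lemma flatZ (x : F) (l : L) (v : V) : flat ((x *: l) *: v) = x *: flat (l *: v).
Proof. by apply/ffunP => i; rewrite !ffunE !mxE scalerAl. Qed.

Lemma flatZ1 (x : F) (v : V) : flat (x%:A *: v) = x *: flat v.
Proof. by rewrite flatZ scale1r. Qed.

Lemma flat0 : flat 0 = 0.
Proof. by apply/ffunP => i; rewrite !ffunE mxE. Qed.

Lemma flat_sum (k : nat) (v : 'I_k -> V) :
  flat (\sum_(i < k) v i) = \sum_(i < k) flat (v i).
Proof. exact: (big_morph flat flatD flat0). Qed.

Lemma flat_inj : injective flat.
Proof.
by move=> v w /ffunP e; apply/rowP => i; have := e i; rewrite !ffunE.
Qed.

Lemma flat_eq0 (v : V) : (flat v == 0) = (v == 0).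
Proof. by rewrite -flat0 (inj_eq flat_inj). Qed.

Lemma flat_surj (w : W) : exists v, w = flat v.
Proof.
by exists (\row_i w i); apply/ffunP => i; rewrite ffunE mxE.
Qed.

Lemma mem_field_reduction (v : V) (w : W) : v != 0 ->
  w \in field_reduction <[v]> <-> exists l, w = flat (l *: v).
Proof.
move=> v0; pose f (l : L) : W := [ffun i => l * vpick <[v]> 0 i].
have linf : linear f.
  move=> x l l'; apply/ffunP => i.
  by rewrite !ffunE mulrDl -scalerAl.
pose fM := GRing.isLinear.Build F L W *:%R f linf.
pose fL : {linear L -> W} := HB.pack f fM.
have fE l : linfun f l = flat (l *: vpick <[v]>).
  by rewrite (lfunE fL); apply/ffunP => i; rewrite !ffunE mxE.
have /vlineP[k vE] := memv_pick <[v]>.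
have k0 : k != 0.
  have : vpick <[v]> != 0 by rewrite vpick0 -dimv_eq0 dim_vline v0.
  by rewrite vE scaler_eq0 negb_or => /andP[].
split=> [/memv_imgP[l _ ->]|[l ->]].
  by exists (l * k); rewrite fE vE scalerA.
apply/memv_imgP; exists (l / k); rewrite ?memvf //.
by rewrite fE vE scalerA divfK.
Qed.

Lemma dim_field_reduction (v : V) : v != 0 ->
  \dim (field_reduction <[v]>) = \dim {: L}.
Proof.
move=> v0; pose f (l : L) : W := flat (l *: v).
have linf : linear f.
  by move=> x l l'; rewrite /f scalerDl flatD flatZ.
pose fM := GRing.isLinear.Build F L W *:%R f linf.
pose fL : {linear L -> W} := HB.pack f fM.
have -> : field_reduction <[v]> = limg (linfun f).
  apply/vspaceP => w; apply/idP/idP.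
    by move/(mem_field_reduction _ v0) => [l ->]; apply/memv_imgP; exists l;
      rewrite ?memvf ?(lfunE fL).
  by move/memv_imgP => [l _ ->]; rewrite (lfunE fL); apply/mem_field_reduction;
    last exists l.
apply: limg_dim_eq; apply/eqP; rewrite -subv0; apply/subvP => l.
rewrite memv_cap memv_ker (lfunE fL) memv0 => /andP[_].
by rewrite flat_eq0 scaler_eq0 (negPf v0) orbF.
Qed.

Variable linf : {vspace V}.
Hypothesis hlinf : \dim linf = 2%N.

Lemma affine_decomposition (a : V) : a \notin linf ->
  forall v, exists l : L, exists2 h, h \in linf & v = l *: a + h.
Proof.
move=> al v; suff: v \in (<[a]> + linf)%VS.
  by move=> /memv_addP[_ /vlineP[l ->] [h hl ->]]; exists l, h.
suff -> : (<[a]> + linf)%VS = fullv by rewrite memvf.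
apply/eqP; rewrite eqEdim subvf dimvf dim_matrix /=.
have a0 : a != 0 by apply: contraNneq al => ->; rewrite mem0v.
rewrite dimv_disjoint_sum ?dim_vline ?a0 ?hlinf //.
apply/eqP; rewrite -subv0; apply/subvP => w; rewrite memv_cap memv0.
move=> /andP[/vlineP[k ->]]; have [->|k0] := eqVneq k 0; rewrite ?scale0r //.
move/(memvZ k^-1); rewrite scalerA mulVf // scale1r => al'.
by rewrite al' in al.
Qed.

Variable K : {vspace W}.
Hypothesis hK : \dim K = (2 * \dim {: L}).+1.
Hypothesis hKlinf : forall P, point_set linf P -> (field_reduction P <= K)%VS.

(** The vectors at infinity form a subspace H of K of F-dimension 2n, so K is
    spanned by H and one further vector k0. Writing k0 = mu a + h0 with h0 at
    infinity shows that mu a can be taken instead of k0. *)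
Lemma ambient_affine_chart (a : V) : a \notin linf ->
  exists2 mu : L, mu != 0 & forall l h, h \in linf ->
    flat (l *: (mu *: a) + h) \in K <-> l \in 1%VS.
Proof.
move=> al; have [h1 [h2 [h1l h2l fh]]] := line_basis hlinf.
have hl := line_coordinates hlinf fh h1l h2l.
have h10 : h1 != 0 by apply: contraTneq fh => ->; rewrite free_cons mem0v.
have h20 : h2 != 0.
  by apply: contraTneq fh => ->; rewrite !free_cons mem0v andbF.
pose H := (field_reduction <[h1]> + field_reduction <[h2]>)%VS.
have HP w : w \in H <-> exists2 h, h \in linf & w = flat h.
  split=> [/memv_addP[_ /(mem_field_reduction _ h10)[l1 ->]]|].
    move=> [_ /(mem_field_reduction _ h20)[l2 ->] ->].
    by exists (l1 *: h1 + l2 *: h2); rewrite ?flatD // memvD // memvZ.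
  move=> [_ /hl[l1 [l2 ->]] ->]; rewrite flatD memv_add //;
  by apply/mem_field_reduction => //; eexists.
have HK : (H <= K)%VS.
  by rewrite subv_add !hKlinf //; split; rewrite ?dim_vline ?h10 ?h20 // -memvE.
have dimH : \dim H = (2 * \dim {: L})%N.
  rewrite dimv_disjoint_sum ?dim_field_reduction ?mul2n ?addnn //.
  apply/eqP; rewrite -subv0; apply/subvP => w; rewrite memv_cap memv0.
  move=> /andP[/(mem_field_reduction _ h10)[l1 ->]].
  move=> /(mem_field_reduction _ h20)[l2] /flat_inj e.
  have [] := free2P fh (_ : l1 *: h1 + (- l2) *: h2 = 0).
    by rewrite e scaleNr subrr.
  by move=> -> _; rewrite scale0r flat0.
have : ~~ (K <= H)%VS by apply/negP => /dimvS; rewrite hK dimH ltnn.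
case/subvPn => k0 k0K k0H; have KE : K = (H + <[k0]>)%VS.
  apply/eqP; rewrite eq_sym eqEdim subv_add HK -memvE k0K hK -dimH.
  rewrite ltn_neqAle dimvS ?addvSl // !andbT; apply/eqP => e.
  have E : H = (H + <[k0]>)%VS.
    by apply/eqP; rewrite eqEdim addvSl -e leqnn.
  by rewrite E memvE addvSr in k0H.
have [v0 k0E] := flat_surj k0.
have [mu [h0 h0l v0E]] := affine_decomposition al v0.
have mu0 : mu != 0.
  apply: contra k0H => /eqP mu0; apply/HP; exists h0 => //.
  by rewrite k0E v0E mu0 scale0r add0r.
exists mu => // l h hh; split=> [|/vlineP[x ->]]; last first.
  have -> : x%:A *: (mu *: a) + h = (h - x%:A *: h0) + x%:A *: v0.
    by rewrite v0E scalerDr addrCA subrK.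
  rewrite flatD flatZ1 -k0E KE memv_add ?memvZ ?memv_line //.
  by apply/HP; eexists; last reflexivity; rewrite memvB // memvZ.
rewrite KE => /memv_addP[_ /HP[h' h'l ->] [_ /vlineP[x ->]]].
rewrite k0E -flatZ1 -flatD v0E => /flat_inj e.
have {}e : (l - x%:A) *: (mu *: a) = h' + x%:A *: h0 - h.
  rewrite scalerBl -[l *: _](addrK h) e scalerDr addrCA.
  by rewrite -[_ - h]addrA [X in X - _]addrC addrK.
have [/eqP|lx] := eqVneq (l - x%:A) 0.
  by rewrite subr_eq0 => /eqP ->; rewrite memvZ ?memv_line.
case/negP: al; have -> : a = ((l - x%:A) * mu)^-1 *: (h' + x%:A *: h0 - h).
  by rewrite -e !scalerA mulVf ?scale1r // mulf_neq0.
by rewrite memvZ // memvB // memvD // memvZ.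
Qed.

Variable a : V.
Hypothesis aK : forall l h, h \in linf ->
  flat (l *: a + h) \in K <-> l \in 1%VS.

Lemma affine_neq0 (h : V) : a \notin linf -> h \in linf -> a + h != 0.
Proof.
move=> al hl; apply: contra al; rewrite addr_eq0 => /eqP ->.
by rewrite memvN.
Qed.

(** Of the L-multiples l (a + h), exactly those with l in F lie in K. *)
Lemma andre_bruck_bose_affine (h : V) : a \notin linf -> h \in linf ->
  andre_bruck_bose K <[a + h]> = <[flat (a + h)]>%VS.
Proof.
move=> al hl; apply/vspaceP => w; rewrite memv_cap; apply/andP/vlineP.
  move=> [/mem_field_reduction -/(_ (affine_neq0 al hl))[l ->]].
  rewrite scalerDr aK ?memvZ // => /vlineP[x ->].
  by exists x; rewrite -scalerDr flatZ1.
move=> [x ->]; rewrite -flatZ1; split.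
  by apply/mem_field_reduction; [exact: affine_neq0 | exists x%:A].
by rewrite scalerDr aK ?memvZ // memv_line.
Qed.

End FieldReductionCoordinates.
(** * Frames adapted to a tangent subplane *)

Section Frames.

Variables (F : finFieldType) (L : fieldExtType F).
Local Notation V := 'rV[L]_3.

Section Subgeometry.

Variables (k : nat) (e : k.-tuple V).
Hypothesis fe : free e.

Definition comb (x : 'rV[F]_k) : V := \sum_i (x 0 i)%:A *: e`_i.

Definition subgeometry : set {vspace V} :=
  [set P | exists2 x, x != 0 & P = <[comb x]>%VS].

Lemma combD (x y : 'rV[F]_k) : comb (x + y) = comb x + comb y.
Proof.
by rewrite -big_split; apply: eq_bigr => i _; rewrite mxE !scalerDl.
Qed.

Lemma combZ (c : F) (x : 'rV[F]_k) : comb (c *: x) = c%:A *: comb x.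
Proof.
rewrite scaler_sumr; apply: eq_bigr => i _.
by rewrite mxE scalerA -scalerAl mul1r scalerA.
Qed.

Lemma comb_inj0 (x : 'rV[F]_k) : comb x = 0 -> x = 0.
Proof.
move=> x0; apply/rowP => i; rewrite mxE; apply/eqP; rewrite -(alg_eq0 L).
by apply/eqP; move/freeP: fe => /(_ (fun i => (x 0 i)%:A)); apply.
Qed.

(** If f = l x, g = m y and f + g = nu r with x, y, r in the F-span of e, then
    l and m are F-multiples of nu: by Cramer's rule, applied to two coordinates
    in which x and y are independent. Hence a frame of points of a line of the
    subgeometry can be taken, up to one common factor, in the F-span of e. *)
Lemma frame_rescaling (f g : V) : free [:: f; g] ->
  subgeometry <[f]>%VS -> subgeometry <[g]>%VS -> subgeometry <[f + g]>%VS ->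
  exists2 nu : L, nu != 0 &
    exists x y : 'rV[F]_k, f = nu *: comb x /\ g = nu *: comb y.
Proof.
move=> ffg [x x0 fx] [y y0 gy] [r r0 fgr].
have /vlineP[l fE] : f \in <[comb x]>%VS by rewrite -fx memv_line.
have /vlineP[m gE] : g \in <[comb y]>%VS by rewrite -gy memv_line.
have /vlineP[nu fgE] : f + g \in <[comb r]>%VS by rewrite -fgr memv_line.
have rel i : l * (x 0 i)%:A + m * (y 0 i)%:A = nu * (r 0 i)%:A.
  apply/eqP; rewrite -subr_eq0; apply/eqP; move: i.
  move/freeP: fe => /(_ (fun i => l * (x 0 i)%:A + m * (y 0 i)%:A
                                  - nu * (r 0 i)%:A)); apply.
  rewrite -[RHS](subrr (f + g)) {2}fgE fE gE !scaler_sumr -big_split -sumrB.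
  by apply: eq_bigr => i _; rewrite scalerBl scalerDl !scalerA.
have l0 : l != 0.
  apply/eqP => l0; have := @free2P _ _ f g 1 0 ffg.
  by rewrite fE l0 !scale0r scaler0 addr0 => -[] // /eqP; rewrite oner_eq0.
have m0 : m != 0.
  apply/eqP => m0; have := @free2P _ _ f g 0 1 ffg.
  by rewrite gE m0 !scale0r scaler0 addr0 => -[] // _ /eqP; rewrite oner_eq0.
have [i xi] : exists i, x 0 i != 0.
  by apply/existsP; apply: contraNT x0 => /existsPn x0; apply/eqP/rowP => i;
    have := x0 i; rewrite negbK mxE => /eqP.
have [j D0] : exists j, x 0 i * y 0 j - x 0 j * y 0 i != 0.
  apply/existsP; apply: contraT => /existsPn D0.
  have yE : y = (y 0 i / x 0 i) *: x.
    apply/rowP => j; have := D0 j; rewrite negbK subr_eq0 mxE => /eqP D.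
    by apply: (mulfI xi); rewrite D; field.
  have /(free2P ffg)[/eqP] : m * (y 0 i / x 0 i)%:A *: f + - l *: g = 0.
    rewrite fE gE {2}yE combZ !scalerA -scalerDl.
    by rewrite [X in X *: _](_ : _ = 0) ?scale0r //; ring.
  by move=> _ /eqP; rewrite oppr_eq0 (negPf l0).
set D := _ - _ in D0.
pose toL : {rmorphism F -> L} := in_alg L.
have DL : toL D != 0 by rewrite fmorph_eq0.
have ri : l * toL (x 0 i) + m * toL (y 0 i) = nu * toL (r 0 i) := rel i.
have rj : l * toL (x 0 j) + m * toL (y 0 j) = nu * toL (r 0 j) := rel j.
have DE : toL D = toL (x 0 i) * toL (y 0 j) - toL (x 0 j) * toL (y 0 i).
  by rewrite /D rmorphB !rmorphM.
pose A := (r 0 i * y 0 j - r 0 j * y 0 i) / D.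
pose B := (x 0 i * r 0 j - x 0 j * r 0 i) / D.
have lE : l = nu * toL A.
  rewrite /A fmorph_div rmorphB !rmorphM; apply: (mulIf DL).
  rewrite -mulrA divfK // mulrBr !mulrA -ri -rj DE; ring.
have mE : m = nu * toL B.
  rewrite /B fmorph_div rmorphB !rmorphM; apply: (mulIf DL).
  rewrite -mulrA divfK // mulrBr ![nu * (_ * _)]mulrCA -ri -rj DE; ring.
exists nu; first by apply: contra l0 => /eqP nu0; rewrite lE nu0 mul0r.
exists (A *: x), (B *: y); rewrite !combZ !scalerA.
by rewrite fE gE lE mE.
Qed.

End Subgeometry.

Lemma subline_subgeometry (b : set {vspace V}) : subline b ->
  exists2 e : 2.-tuple V, free e & b = subgeometry e.
Proof.
move=> [u [v [fuv ->]]]; exists [tuple u; v] => //.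
have combE (x y : F) : comb [tuple u; v] (param x y) = x%:A *: u + y%:A *: v.
  by rewrite /comb !big_ord_recl big_ord0 addr0 !mxE.
apply/seteqP; split=> P.
  move=> [x [y [xy ->]]]; exists (param x y); last by rewrite combE.
  apply: contra xy => /eqP/rowP e; rewrite xpair_eqE.
  by have := e 0; have := e 1; rewrite !mxE /= => -> ->; rewrite eqxx.
move=> [x x0 ->]; exists (x 0 0), (x 0 1); split.
  apply: contra x0; rewrite xpair_eqE => /andP[/eqP e0 /eqP e1]; apply/eqP.
  by apply: row2_eqP; rewrite mxE.
rewrite -combE; congr (<[comb _ _]>)%VS.
by apply: row2_eqP; rewrite !mxE.
Qed.

Lemma subplane_subgeometry (B : set {vspace V}) : subplane B ->
  exists2 e : 3.-tuple V, free e & B = subgeometry e.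
Proof.
move=> [u [v [w [fuvw ->]]]]; exists [tuple u; v; w] => //.
pose row3 (x y z : F) : 'rV[F]_3 := \row_j [:: x; y; z]`_j.
have combE (x y z : F) : comb [tuple u; v; w] (row3 x y z) =
    x%:A *: u + y%:A *: v + z%:A *: w.
  by rewrite /comb !big_ord_recl big_ord0 addr0 !mxE /= addrA.
have row3E (x : 'rV[F]_3) : x = row3 (x 0 0) (x 0 1) (x 0 2).
  apply/rowP => j; rewrite mxE.
  by case: j => -[|[|[|//]]] jlt /=; congr (x 0 _); apply: val_inj.
apply/seteqP; split=> P.
  move=> [x [y [z [xyz ->]]]]; exists (row3 x y z); last by rewrite combE.
  apply: contra xyz => /eqP/rowP e; rewrite !xpair_eqE.
  by have := (e 0, e 1, e 2); rewrite !mxE /= => -[[-> ->] ->]; rewrite eqxx.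
move=> [x x0 ->]; exists (x 0 0), (x 0 1), (x 0 2).
rewrite -combE -row3E; split=> //.
apply: contra x0 => /eqP[e0 e1 e2]; rewrite (row3E x) e0 e1 e2.
by apply/eqP/rowP => j; rewrite !mxE; case: j => -[|[|[|//]]].
Qed.

Lemma subline_frame (b : set {vspace V}) (u v : V) (r s : F) : subline b ->
  free [:: u; v] -> b <[u]>%VS -> b <[v]>%VS -> b <[u + v]>%VS ->
  (r != 0) || (s != 0) -> b <[r%:A *: u + s%:A *: v]>%VS.
Proof.
move=> /subline_subgeometry[e fe ->] fuv bu bv buv rs.
have [nu nu0 [x [y [uE vE]]]] := frame_rescaling fe fuv bu bv buv.
have cE : r%:A *: u + s%:A *: v = nu *: comb e (r *: x + s *: y).
  rewrite combD !combZ uE vE scalerDr !scalerA.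
  by rewrite ![_ * nu]mulrC.
exists (r *: x + s *: y); last by rewrite cE line_scale.
apply: contraTneq rs => c0.
have : comb e 0 = 0 by rewrite /comb big1 // => i _; rewrite mxE !scale0r.
move: cE; rewrite c0 => + e0; rewrite e0 scaler0 => /(free2P fuv)[/eqP + /eqP].
by rewrite !alg_eq0 => /eqP -> /eqP ->; rewrite eqxx.
Qed.

(** A representative of T, scaled by the same factor as u and v, completes u and
    v to an F-basis of the F-span (up to this factor) that defines B: an
    F-relation between the three would put T on b or make u, v dependent. *)
Lemma subplane_frame (B b : set {vspace V}) (T : {vspace V}) (u v : V) :
  subplane B -> subline b -> b `<=` B -> B T -> ~ b T ->
  free [:: u; v] -> b <[u]>%VS -> b <[v]>%VS -> b <[u + v]>%VS ->
  exists t : V, [/\ t != 0, T = <[t]>%VS &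
    forall P, B P <-> exists r s p : F,
      [|| r != 0, s != 0 | p != 0] /\
      P = <[r%:A *: u + s%:A *: v + p%:A *: t]>%VS].
Proof.
move=> /subplane_subgeometry[e fe BE] sb bB BT nbT fuv bu bv buv.
have BbE P : b P -> subgeometry e P by rewrite -BE; apply: bB.
have [nu nu0 [x [y [uE vE]]]] :=
  frame_rescaling fe fuv (BbE _ bu) (BbE _ bv) (BbE _ buv).
have [x0 x0n TE] : subgeometry e T by rewrite -BE.
pose t := nu *: comb e x0.
have cE r s p : nu *: comb e (r *: x + s *: y + p *: x0) =
    r%:A *: u + s%:A *: v + p%:A *: t.
  by rewrite !combD !combZ uE vE !scalerDr !scalerA ![_ * nu]mulrC.
have TtE : T = <[t]>%VS by rewrite TE line_scale.
have t0 : t != 0.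
  by rewrite scaler_eq0 negb_or nu0; apply: contra x0n => /eqP/(comb_inj0 fe)->.
have combe0 : comb e 0 = 0.
  by rewrite /comb big1 // => i _; rewrite mxE !scale0r.
have ind r s p : r *: x + s *: y + p *: x0 = 0 -> [/\ r = 0, s = 0 & p = 0].
  move=> c0; have := cE r s p; rewrite c0 combe0 scaler0 => /esym.
  have [->|p0] := eqVneq p 0.
    rewrite !scale0r addr0 => /(free2P fuv)[/eqP + /eqP].
    by rewrite !alg_eq0 => /eqP -> /eqP ->.
  move=> uvt; case: nbT.
  have tE : (- (p^-1 * r))%:A *: u + (- (p^-1 * s))%:A *: v = t.
    apply/eqP; rewrite -subr_eq0 -oppr_eq0 opprB; apply/eqP.
    have := congr1 (fun w => (p^-1)%:A *: w) uvt; rewrite scaler0 => <-.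
    rewrite !scalerDr !scalerA -!algM mulVf // !scale1r.
    by rewrite !scaleNr opprD !opprK addrC mul1r.
  rewrite TtE -tE; apply: subline_frame => //.
  apply: contraT; rewrite negb_or !negbK => /andP[/eqP r0 /eqP s0].
  by rewrite -tE r0 s0 !scale0r addr0 eqxx in t0.
exists t; split=> // P; rewrite BE; split=> [[c c0 ->]|[r [s [p [rsp ->]]]]].
  have : c \in <<[tuple x; y; x0]>>%VS.
    suff /eqP -> : (<<[tuple x; y; x0]>> == fullv)%VS by rewrite memvf.
    rewrite eqEdim subvf dimvf dim_matrix /=.
    suff /eqP -> : free [:: x; y; x0] by [].
    apply/(@freeP _ _ _ [tuple x; y; x0]) => k.
    rewrite !big_ord_recl big_ord0 addr0 addrA /= => /ind[k0 k1 k2].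
    by case=> -[|[|[|//]]] lt; [rewrite -k0|rewrite -k1|rewrite -k2]; congr k;
      apply: val_inj.
  move=> /coord_span; rewrite !big_ord_recl big_ord0 addr0 addrA /=.
  set r := coord _ _ _; set s := coord _ _ _; set p := coord _ _ _ => cE'.
  exists r, s, p; split; last by rewrite -cE -cE' line_scale.
  apply: contraNT c0; rewrite !negb_or !negbK.
  move=> /and3P[/eqP r0 /eqP s0 /eqP p0].
  by rewrite cE' r0 s0 p0 !scale0r !addr0.
exists (r *: x + s *: y + p *: x0); last by rewrite -cE line_scale.
by apply: contraTneq rsp => /ind[-> -> ->]; rewrite eqxx.
Qed.

(** The coordinate along the affine vector a of the point with parameter y. *)
Definition denominator (z : L) (y : 'rV[F]_2) : L :=
  (y 0 0)%:A - (y 0 1)%:A * z.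

(** A frame (u, v, u + v) of b in which Theta = <u + z v> is supplied by the
    definition of the degree; then a = v and h = u + z v, since
    r u + s v = (s - r z) a + r h. *)
Lemma adapted_frame (linf : {vspace V}) (B b : set {vspace V})
    (T lb : {vspace V}) :
  \dim linf = 2%N -> \dim lb = 2%N -> subplane B -> tangent_at B linf T ->
  subplane_line B b -> ~ b T -> b `<=` point_set lb ->
  exists (a h t : V) (z : L),
  [/\ [/\ a \in lb, a \notin linf, h \in lb, h \in linf & h != 0],
      [/\ t != 0, t \in linf & T = <[t]>%VS], z \notin 1%VS,
      point_degree b (lb :&: linf)%VS = \dim <<1; z>>%VS &
      forall P, B P <-> exists (y : 'rV[F]_2) (p : F), (y != 0) || (p != 0) /\
        P = <[denominator z y *: a + (y 0%R 1%R)%:A *: h + p%:A *: t]>%VS].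
Proof.
move=> dlinf dlb sB tB [sb bB] nbT blb.
have BT : B T by have [] : (B `&` point_set linf) T by rewrite tB.
have linfT : (T <= linf)%VS.
  by have [_ []] : (B `&` point_set linf) T by rewrite tB.
have b_affine P : b P -> ~ (P <= linf)%VS.
  move=> bP Pl; apply: nbT; have : (B `&` point_set linf) P.
    by split; [exact: bB | split=> //; have [] := blb _ bP].
  by rewrite tB /= => <-.
have b_mem w : b <[w]>%VS -> w \in lb /\ w \notin linf.
  move=> bw; split; first by have [_] := blb _ bw; rewrite memvE.
  by apply/negP; rewrite memvE; apply: b_affine.
have nbTheta : ~ b (lb :&: linf)%VS.
  by move=> /b_affine; apply; exact: capvSr.
have : exists d, frame_degree b (lb :&: linf)%VS d.
  move: (sb) => [u [v [fuv bE]]].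
  have F10 (x y : F) : (x != 0) || (y != 0) ->
      b <[x%:A *: u + y%:A *: v]>%VS.
    move=> xy; rewrite bE; exists x, y; split=> //.
    by move: xy; rewrite -negb_and xpair_eqE.
  have bu : b <[u]>%VS.
    by have := F10 1 0; rewrite !scale0r !scale1r addr0 oner_eq0; apply.
  have bv : b <[v]>%VS.
    by have := F10 0 1; rewrite !scale0r !scale1r add0r oner_eq0 orbT; apply.
  have buv : b <[u + v]>%VS.
    by have := F10 1 1; rewrite !scale1r oner_eq0; apply.
  have [[ul un] [vl vn]] := (b_mem _ bu, b_mem _ bv).
  have Theta0 : (lb :&: linf)%VS != 0%VS.
    have := dimv_sum_cap lb linf; rewrite dlb dlinf -dimv_eq0 => e.
    have : (\dim (lb + linf) <= 3)%N.
      by apply: leq_trans (dimvS (subvf _)) _; rewrite dimvf dim_matrix.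
    by apply: contraTneq => d0; rewrite d0 addn0 in e; rewrite e.
  have := memv_pick (lb :&: linf)%VS; rewrite memv_cap => /andP[hl hinf].
  have hn0 : vpick (lb :&: linf)%VS != 0 by rewrite vpick0.
  have ThetaE : (lb :&: linf)%VS = <[vpick (lb :&: linf)]>%VS.
    apply/eqP; rewrite eq_sym eqEdim -memvE memv_pick dim_vline hn0 /=.
    rewrite leqNgt; apply/negP => d2; case/negP: un.
    have /eqP lbE : (lb :&: linf)%VS == lb by rewrite eqEdim capvSl dlb.
    have : u \in (lb :&: linf)%VS by rewrite lbE.
    by rewrite memv_cap => /andP[].
  have [x [y hE]] := line_coordinates dlb fuv ul vl hl.
  have x0 : x != 0.
    apply: contra vn => /eqP x0; move: hE hn0 hinf; rewrite x0 scale0r add0r.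
    move=> ->; rewrite scaler_eq0 negb_or => /andP[y0 _] /(memvZ y^-1).
    by rewrite scalerA mulVf // scale1r.
  exists (\dim <<1; y / x>>%VS), u, v, (y / x); split=> //.
  rewrite ThetaE hE -(line_scale _ (invr_neq0 x0)) scalerDr !scalerA mulVf //.
  by rewrite scale1r mulrC.
move=> /(xgetPex 0%N) [u [v [z [fuv [bu bv buv] ThetaE degE]]]].
have [t [t0 TE BE]] := subplane_frame sB sb bB BT nbT fuv bu bv buv.
have [vl vn] := b_mem _ bv.
have := memv_line (u + z *: v); rewrite -ThetaE memv_cap => /andP[hl hinf].
exists v, (u + z *: v), t, z; split.
- split=> //; apply/eqP => e; have [/eqP] : (1 : L) = 0 /\ z = 0.
    by apply: (free2P fuv); rewrite scale1r.
  by rewrite oner_eq0.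
- by split=> //; rewrite memvE -TE.
- apply/negP => /vlineP[x zE]; apply: nbTheta; rewrite ThetaE zE.
  have := @subline_frame b u v 1 x sb fuv bu bv buv.
  by rewrite !scale1r oner_eq0; apply.
- by rewrite /point_degree; case: asboolP.
have combE (r s p : F) : r%:A *: u + s%:A *: v + p%:A *: t =
    (s%:A - r%:A * z) *: v + r%:A *: (u + z *: v) + p%:A *: t.
  by congr (_ + _); rewrite scalerDr scalerA scalerBl addrCA subrK.
move=> P; rewrite BE; split=> [[r [s [p [rsp ->]]]]|[y [p [yp ->]]]].
  exists (param s r), p; rewrite /denominator !paramE combE; split=> //.
  move: rsp; rewrite orbA orbC => /orP[->|rs]; rewrite ?orbT //.
  apply/orP; left.
  apply: contraTneq rs => /rowP e.
  by have := (e 0, e 1); rewrite !mxE /= => -[-> ->]; rewrite eqxx.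
exists (y 0 1), (y 0 0), p; rewrite combE; split=> //.
move: yp => /orP[y0|->]; rewrite ?orbT // orbA; apply/orP; left.
apply: contraNT y0; rewrite negb_or !negbK => /andP[/eqP e1 /eqP e0].
by apply/eqP/row2_eqP; rewrite mxE.
Qed.

End Frames.
(** * The ruled surface *)

Section RuledSurface.

Variables (F : finFieldType) (L : fieldExtType F).
Local Notation q := #|F|.
Local Notation V := 'rV[L]_3.
Local Notation W := {ffun 'I_3 -> L}.

(** The polynomials p a + g h for C0 and f t for C1, in both ranges of m. Their
    leading coefficients have to represent the points with y = (1, 0), where
    y1 / (y0 - y1 z) = 0 and 1 / (y0 - y1 z) = 1: this is why g has degree less
    than d while f has leading coefficient 1. *)
Lemma curve_forms (z : L) (m := \dim <<1; z>>%VS) (d := minn q m) :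
  z \notin 1%VS ->
  exists (p : {poly F}) (g : {poly L}) (d' : nat) (f : {poly L}),
  [/\ [/\ size p = d.+1, forall s, p.[s] != 0,
          forall s, g.[s%:A] * (s%:A - z) = p.[s]%:A,
          (size g <= d)%N & free (mkseq (nth 0%R g) d)],
      [/\ forall s, exists2 c : F, c != 0 & f.[s%:A] * (s%:A - z) = c%:A,
          (size f <= d'.+1)%N, f`_d' = 1 & free (mkseq (nth 0%R f) d'.+1)],
      (d' <= q)%N &
      if (m < q)%N then d' = (m - 1)%N else d' = (q - 1)%N \/ d' = q].
Proof.
move=> zF; rewrite /d; have [qm|mq] := ltnP q m.
  have q1 := card_field_gt1 F.
  have [g [gE szg fg fh]] := large_degree_forms zF qm.
  have szXq : size ('X^q - 'X : {poly F}) = q.+1.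
    by rewrite size_polyDl size_polyXn // size_polyN size_polyX.
  exists ('X^q - 'X + 1), g, q, (g + ('X^q - 'X)); split=> //.
  - have p1 s : ('X^q - 'X + 1 : {poly F}).[s] = 1.
      by rewrite !hornerE expf_card subrr add0r.
    split=> // [|s|s].
        by rewrite size_polyDl ?szXq // size_poly1 ltnS ltnW.
      by rewrite p1 oner_eq0.
    by rewrite p1 gE scale1r.
  - split=> // [s||].
    + exists 1; rewrite ?oner_eq0 // scale1r -[RHS](gE s) !hornerE.
      by rewrite -(rmorphXn (in_alg L)) /= expf_card addrK.
    + apply: leq_trans (size_polyD _ _) _; rewrite geq_max (leq_trans szg) //=.
      by rewrite size_polyDl ?size_polyXn // size_polyN size_polyX.
    + rewrite coefD coefB coefXn coefX eqxx nth_default // add0r.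
      by rewrite gtn_eqF // subr0.
  - by rewrite ltnNge ltnW //=; right.
have m1 : (1 < m)%N := degree_gt1 zF.
have m0 : (0 < m)%N := ltnW m1.
have [p [g [szp p0 gE szg [glead fg]]]] := small_degree_forms zF.
exists p, g, m.-1, g; rewrite prednK //; split=> //.
- by split=> // s; exists p.[s].
- exact: leq_trans (leq_pred _) mq.
by rewrite -subn1; case: ltngtP mq => // -> _; left.
Qed.

Section Surface.

Variables (linf lb : {vspace V}) (K : {vspace W}) (a h t : V) (z : L).
Hypothesis al : a \notin linf.
Hypothesis hl : h \in linf.
Hypothesis h0 : h != 0.
Hypothesis tl : t \in linf.
Hypothesis t0 : t != 0.
Hypothesis zF : z \notin 1%VS.
Hypothesis aK : forall l v, v \in linf ->
  flat (l *: a + v) \in K <-> l \in 1%VS.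

(** The F-vectors X_y and Y_y representing the points of the curves C0 and C1
    with parameter y. *)
Definition directrix_point (y : 'rV[F]_2) : W :=
  flat (a + ((y 0 1)%:A / denominator z y) *: h).

Definition direction_point (y : 'rV[F]_2) : W :=
  flat ((denominator z y)^-1 *: t).

Lemma denominator_neq0 (y : 'rV[F]_2) : y != 0 -> denominator z y != 0.
Proof.
apply: contra; rewrite subr_eq0 => /eqP e; apply/eqP.
have y1 : y 0 1 = 0.
  apply/eqP; apply: contraT => y1; case/negP: zF.
  have -> : z = (y 0 0 / y 0 1)%:A.
    apply: (mulfI (_ : (y 0 1)%:A != 0)); first by rewrite alg_eq0.
    by rewrite -e -algM mulrC divfK.
  by rewrite memvZ ?memv_line.
apply: row2_eqP; rewrite mxE //; apply/eqP; rewrite -(alg_eq0 L).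
by rewrite e y1 scale0r mul0r.
Qed.

Lemma denominatorZ (c : F) (y : 'rV[F]_2) :
  denominator z (c *: y) = c%:A * denominator z y.
Proof. by rewrite /denominator !mxE !algM; ring. Qed.

Lemma affine_coord_inj (l l' : L) (v v' : V) : v \in linf -> v' \in linf ->
  l *: a + v = l' *: a + v' -> l = l' /\ v = v'.
Proof.
move=> vl v'l e; suff ll : l = l' by split=> //; move: e; rewrite ll => /addrI.
apply/eqP; rewrite -subr_eq0; apply: contraT => ll; case/negP: al.
have {}e : (l - l') *: a = v' - v.
  by rewrite scalerBl -[l *: a](addrK v) e addrAC [_ + v']addrC addrK.
have -> : a = (l - l')^-1 *: (v' - v) by rewrite -e scalerA mulVf // scale1r.
by rewrite memvZ // memvB.
Qed.

Lemma directrix_pointZ (c : F) (y : 'rV[F]_2) : c != 0 ->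
  directrix_point (c *: y) = directrix_point y.
Proof.
move=> c0; rewrite /directrix_point denominatorZ mxE algM -mulf_div divff.
  by rewrite mul1r.
by rewrite alg_eq0.
Qed.

Lemma direction_pointZ (c : F) (y : 'rV[F]_2) : c != 0 ->
  direction_point (c *: y) = c^-1 *: direction_point y.
Proof.
move=> c0; rewrite /direction_point denominatorZ -flatZ invfM.
by rewrite -(fmorphV (in_alg L)) /= mulr_algl.
Qed.

Lemma direction_point_neq0 (y : 'rV[F]_2) : y != 0 -> direction_point y != 0.
Proof.
by move=> y0; rewrite flat_eq0 scaler_eq0 invr_eq0 negb_or denominator_neq0.
Qed.

(** The coefficient of a is 1 in both vectors, so spanning the same point means
    being equal, hence y1 / (y0 - y1 z) = y'1 / (y'0 - y'1 z). *)
Lemma directrix_point_inj (y y' : 'rV[F]_2) : y != 0 -> y' != 0 ->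
  <[directrix_point y]>%VS = <[directrix_point y']>%VS ->
  exists2 c : F, c != 0 & y' = c *: y.
Proof.
move=> y0 y'0 e.
have /vlineP[x] : directrix_point y \in <[directrix_point y']>%VS.
  by rewrite -e memv_line.
rewrite -flatZ1 => /flat_inj; rewrite scalerDr -[X in X + _]scale1r.
move=> /affine_coord_inj -/(_ (memvZ _ hl) (memvZ _ (memvZ _ hl)))[<-].
rewrite scale1r => /eqP; rewrite -subr_eq0 -scalerBl scaler_eq0 (negPf h0) orbF.
rewrite subr_eq0 eqr_div ?denominator_neq0 // => /eqP e1.
have {}e1 : y 0 1 * y' 0 0 = y' 0 1 * y 0 0.
  apply/eqP; rewrite -subr_eq0 -(alg_eq0 L) scalerBl !algM subr_eq0; apply/eqP.
  have := congr1 (fun w => w + (y 0 1)%:A * (y' 0 1)%:A * z) e1.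
  by rewrite /denominator !mulrBr => e2; ring: e2.
have [y00|y00] := eqVneq (y 0 0) 0.
  have y10 : y 0 1 != 0.
    by apply: contraNneq y0 => y10; apply/eqP/row2_eqP; rewrite mxE.
  have y'00 : y' 0 0 = 0.
    by apply: (mulfI y10); rewrite e1 y00 !mulr0.
  exists (y' 0 1 / y 0 1); last first.
    by apply: row2_eqP; rewrite mxE ?y00 ?y'00 ?mulr0 // divfK.
  rewrite mulf_neq0 ?invr_eq0 //; apply: contraNneq y'0 => y'10.
  by apply/eqP/row2_eqP; rewrite mxE.
exists (y' 0 0 / y 0 0).
  rewrite mulf_neq0 ?invr_eq0 //; apply: contraNneq y'0 => y'00.
  apply/eqP/row2_eqP; rewrite mxE //; apply: (mulIf y00).
  by rewrite -e1 y'00 mulr0 mul0r.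
apply: row2_eqP; rewrite mxE ?divfK //.
by apply: (mulIf y00); rewrite mulrAC divfK // -e1 mulrC.
Qed.

(** If the denominators of y and y' differ by a factor x in F, then that of
    y' - x y vanishes; but 1 and z are independent over F. *)
Lemma direction_point_inj (y y' : 'rV[F]_2) : y != 0 -> y' != 0 ->
  <[direction_point y]>%VS = <[direction_point y']>%VS ->
  exists2 c : F, c != 0 & y' = c *: y.
Proof.
move=> y0 y'0 e.
have /vlineP[x] : direction_point y \in <[direction_point y']>%VS.
  by rewrite -e memv_line.
rewrite -flatZ1 scalerA => /flat_inj/eqP; rewrite -subr_eq0 -scalerBl.
rewrite scaler_eq0 (negPf t0) orbF subr_eq0 => /eqP e1.
have {}e1 : denominator z (y' - x *: y) = 0.
  have -> : denominator z (y' - x *: y) =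
      denominator z y' - x%:A * denominator z y.
    by rewrite /denominator !mxE !scalerBl !algM; ring.
  have dy := denominator_neq0 y0; have dy' := denominator_neq0 y'0.
  apply/eqP; rewrite subr_eq0; apply/eqP.
  by rewrite -[LHS](mulfK dy) -mulrA e1; field.
have : y' - x *: y = 0.
  apply/eqP; apply: contraT => /denominator_neq0.
  by rewrite e1 eqxx.
move=> /eqP; rewrite subr_eq0 => /eqP y'E; exists x => //.
by apply: contraNneq y'0 => x0; rewrite y'E x0 scale0r.
Qed.

Lemma directrix_curve (p : {poly F}) (g : {poly L}) (d : nat) :
  size p = d.+1 -> (forall s, p.[s] != 0) ->
  (forall s, g.[s%:A] * (s%:A - z) = p.[s]%:A) -> (size g <= d)%N ->
  forall y : 'rV[F]_2, y != 0 ->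
    nrc_point (nrc_tuple d (fun j => flat ((p`_j)%:A *: a + g`_j *: h))) y
    = <[directrix_point y]>%VS.
Proof.
move=> szp p0 gE szg y /param_normal_form[c c0 [->|[s ->]]];
  rewrite nrc_pointZ // directrix_pointZ //.
  rewrite nrc_point_infinity [g`_d]nth_default // scale0r addr0 flatZ1.
  rewrite line_scale.
    by rewrite /directrix_point !paramE scale0r mul0r scale0r addr0.
  by rewrite -[d]/(d.+1.-1) -szp -lead_coefE lead_coef_eq0 -size_poly_eq0 szp.
rewrite nrc_point_affine.
have -> : \sum_(j < d.+1) s ^+ j *: flat ((p`_j)%:A *: a + g`_j *: h)
    = flat (p.[s]%:A *: a + g.[s%:A] *: h).
  rewrite (horner_sum_coef _ (leqW szg)) (horner_coef_wide _ (eq_leq szp)).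
  rewrite !scaler_suml -big_split flat_sum; apply: eq_bigr => j _.
  rewrite -flatZ1 scalerDr !scalerA -algM.
  by congr (flat (_ + _)); rewrite ?[s ^+ j * _]mulrC // mulr_algl.
have -> : g.[s%:A] = p.[s]%:A * (s%:A - z)^-1.
  by rewrite -gE mulfK // sub_alg_neq0.
rewrite -scalerA -scalerDr flatZ1 line_scale //.
by rewrite /directrix_point /denominator !paramE scale1r !mul1r.
Qed.

Lemma direction_curve (f : {poly L}) (d : nat) :
  (forall s, exists2 c : F, c != 0 & f.[s%:A] * (s%:A - z) = c%:A) ->
  (size f <= d.+1)%N -> f`_d = 1 ->
  forall y : 'rV[F]_2, y != 0 ->
    nrc_point (nrc_tuple d (fun j => flat (f`_j *: t))) y
    = <[direction_point y]>%VS.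
Proof.
move=> fE szf fd y /param_normal_form[c c0 [->|[s ->]]];
  rewrite nrc_pointZ // direction_pointZ // line_scale ?invr_eq0 //.
  rewrite nrc_point_infinity fd scale1r /direction_point /denominator !paramE.
  by rewrite scale1r scale0r mul0r subr0 invr1 scale1r.
rewrite nrc_point_affine.
have -> : \sum_(j < d.+1) s ^+ j *: flat (f`_j *: t) = flat (f.[s%:A] *: t).
  rewrite (horner_sum_coef _ szf) scaler_suml flat_sum.
  by apply: eq_bigr => j _; rewrite flatZ.
have [x x0 fx] := fE s.
have -> : f.[s%:A] = x%:A * (s%:A - z)^-1 by rewrite -fx mulfK // sub_alg_neq0.
rewrite -scalerA flatZ1 line_scale //.
by rewrite /direction_point /denominator !paramE scale1r mul1r.
Qed.

(** As a and h are independent over L, a relation between the coefficients gives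
    one between those of g, and then only the leading coefficient of p a
    remains. *)
Lemma directrix_free (p : {poly F}) (g : {poly L}) (d : nat) :
  size p = d.+1 -> (size g <= d)%N -> free (mkseq (nth 0%R g) d) ->
  free (mkseq (fun j => flat ((p`_j)%:A *: a + g`_j *: h)) d.+1).
Proof.
move=> szp szg /free_mkseqP fg; apply/free_mkseqP => c c0.
have {c0} : flat ((\sum_(j < d.+1) c j *: (p`_j)%:A) *: a
                  + (\sum_(j < d.+1) c j *: g`_j) *: h) = 0.
  rewrite -[RHS]c0 !scaler_suml -big_split flat_sum; apply: eq_bigr => j _.
  by rewrite -flatZ1 scalerDr; congr (flat (_ + _));
    rewrite [RHS]scalerA mulr_algl.
move/eqP; rewrite flat_eq0 => /eqP e0.
have [|e1 /eqP e2] := @affine_coord_inj (\sum_(j < d.+1) c j *: (p`_j)%:A) 0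
  ((\sum_(j < d.+1) c j *: g`_j) *: h) 0 (memvZ _ hl) (mem0v _).
  by rewrite e0 scale0r addr0.
move: e2; rewrite scaler_eq0 (negPf h0) orbF big_ord_recr /=.
rewrite [g`_d]nth_default // scaler0 addr0 => /eqP/fg cd0 j.
rewrite ltnS leq_eqVlt => /predU1P[->|]; last exact: cd0.
move: e1; rewrite big_ord_recr big1 /= => [|i _].
  2: by rewrite cd0 // scale0r.
move=> /eqP; rewrite add0r scaler_eq0 alg_eq0 => /orP[/eqP//|].
rewrite -[X in p`_X]/(d.+1.-1) -szp -lead_coefE lead_coef_eq0.
by rewrite -size_poly_eq0 szp.
Qed.

Lemma direction_free (f : {poly L}) (d : nat) :
  free (mkseq (nth 0%R f) d.+1) ->
  free (mkseq (fun j => flat (f`_j *: t)) d.+1).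
Proof.
move=> /free_mkseqP ff; apply/free_mkseqP => c c0; apply: ff.
apply/eqP; have /eqP : flat ((\sum_(j < d.+1) c j *: f`_j) *: t) = 0.
  rewrite -[RHS]c0 scaler_suml flat_sum.
  by apply: eq_bigr => j _; rewrite flatZ.
by rewrite flat_eq0 scaler_eq0 (negPf t0) orbF.
Qed.

Lemma surface_vectorE (y : 'rV[F]_2) (s : F) : y != 0 ->
  denominator z y *: a + (y 0 1)%:A *: h + s%:A *: t =
  denominator z y *: (a + (((y 0 1)%:A / denominator z y) *: h
                           + (s *: (denominator z y)^-1) *: t)).
Proof.
move=> /denominator_neq0 d0; rewrite !scalerDr !scalerA addrA mulrCA divff //.
by rewrite mulr1 -scalerAr divff.
Qed.

Lemma phi_surface_point (y : 'rV[F]_2) (s : F) : y != 0 ->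
  andre_bruck_bose K
    <[denominator z y *: a + (y 0%R 1%R)%:A *: h + s%:A *: t]>%VS =
  <[directrix_point y + s *: direction_point y]>%VS.
Proof.
move=> y0; rewrite surface_vectorE // line_scale ?denominator_neq0 //.
rewrite (andre_bruck_bose_affine aK) ?memvD ?memvZ //.
by rewrite /directrix_point /direction_point -flatZ -flatD addrA.
Qed.

Lemma surface_vector_affine (y : 'rV[F]_2) (s : F) : y != 0 ->
  denominator z y *: a + (y 0 1)%:A *: h + s%:A *: t \notin linf.
Proof.
move=> y0; rewrite surface_vectorE //; apply: contra al => vl.
move/(memvZ (denominator z y)^-1): vl.
rewrite scalerA mulVf ?denominator_neq0 // scale1r.
by rewrite rpredDr ?memvD ?memvZ.
Qed.

Lemma surface_point_affine (y : 'rV[F]_2) (s : F) : y != 0 ->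
  ~ point_set linf
      <[denominator z y *: a + (y 0%R 1%R)%:A *: h + s%:A *: t]>%VS.
Proof. by move=> y0 [_]; rewrite -memvE; apply/negP/surface_vector_affine. Qed.

Lemma directrix_direction (y : 'rV[F]_2) (s : F) :
  directrix_point y + s *: direction_point y \notin <[direction_point y]>%VS.
Proof.
apply/vlineP => -[x]; rewrite /directrix_point /direction_point -!flatZ -flatD.
move=> /flat_inj e; case/negP: al.
have -> : a = (x *: (denominator z y)^-1) *: t
    - ((y 0 1)%:A / denominator z y) *: h - (s *: (denominator z y)^-1) *: t.
  by rewrite -e addrAC !addrK.
by rewrite !memvB ?memvZ.
Qed.

Lemma surface_line_pointP (y : 'rV[F]_2) (Q : {vspace W}) : y != 0 ->
  (point_set (<[directrix_point y]> + <[direction_point y]>)%VS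
     `\ <[direction_point y]>%VS) Q <->
  exists s : F, Q = <[directrix_point y + s *: direction_point y]>%VS.
Proof.
move=> y0; split=> [[[dQ QXY] /= QY]|[s ->]].
  have Q0 : vpick Q != 0 by rewrite vpick0 -dimv_eq0 dQ.
  have QE : Q = <[vpick Q]>%VS.
    by apply/eqP; rewrite eq_sym eqEdim -memvE memv_pick dQ dim_vline Q0.
  have /memv_addP[_ /vlineP[x ->] [_ /vlineP[w ->] QwE]] :
      vpick Q \in (<[directrix_point y]> + <[direction_point y]>)%VS.
    exact: subvP QXY _ (memv_pick Q).
  have [x0|x0] := eqVneq x 0.
    case: QY; rewrite QE QwE x0 scale0r add0r line_scale //.
    by apply: contraNneq Q0 => w0; rewrite QwE x0 w0 !scale0r addr0.
  exists (w / x); rewrite QE QwE -[RHS](line_scale _ x0) scalerDr scalerA.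
  by rewrite mulrC divfK.
split; first split.
- rewrite dim_vline; have [e|//] := eqVneq _ 0.
  by have := directrix_direction y s; rewrite e mem0v.
- by rewrite -memvE memv_add ?memv_line // memvZ ?memv_line.
move=> /= e; have := directrix_direction y s.
by rewrite -e memv_line.
Qed.

(** The parameter y carries all the data: C0 and C1 are the curves of points
    <X_y> and <Y_y>, kappa keeps y, and the points of B with parameter y fill
    the affine line joining <X_y> to <Y_y>. *)
Lemma tangent_subplane_ruled (B : set {vspace V}) (m := \dim <<1; z>>%VS) :
  a \in lb -> h \in lb ->
  (forall P, B P <-> exists (y : 'rV[F]_2) (s : F), (y != 0) || (s != 0) /\
     P = <[denominator z y *: a + (y 0%R 1%R)%:A *: h + s%:A *: t]>%VS) ->
  exists (C0 C1 : set {vspace W}) (delta' : nat)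
         (kappa : {vspace W} -> {vspace W}),
  [/\ normal_rational_curve (minn q m) C0 /\
        C0 `<=` andre_bruck_bose K @` (point_set lb `\` point_set linf),
      normal_rational_curve delta' C1 /\
        C1 `<=` point_set (field_reduction <[t]>%VS),
      (if (m < q)%N then delta' = (m - 1)%N
       else delta' = (q - 1)%N \/ delta' = q),
      nrc_projectivity (minn q m) delta' C0 C1 kappa &
      andre_bruck_bose K @` (B `\` point_set linf) = ruled_surface C0 kappa].
Proof.
move=> alb hlb BE.
have [p [g [d' [f [[szp p0 gE szg fg] [fE szf fd ff] d'q d'm]]]]] :=
  curve_forms zF.
pose c := nrc_tuple (minn q m) (fun j => flat ((p`_j)%:A *: a + g`_j *: h)).
pose d := nrc_tuple d' (fun j => flat (f`_j *: t)).
have cE y : y != 0 -> nrc_point c y = <[directrix_point y]>%VS.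
  exact: directrix_curve.
have dE y : y != 0 -> nrc_point d y = <[direction_point y]>%VS.
  exact: direction_curve.
have cd y y' : y != 0 -> y' != 0 -> nrc_point c y = nrc_point c y' ->
    nrc_point d y = nrc_point d y'.
  move=> y0 y'0; rewrite !cE // !dE //.
  move=> /(directrix_point_inj y0 y'0)[x x0 ->].
  by rewrite direction_pointZ // line_scale ?invr_eq0.
have [kappa kE] := factor_through 0 cd.
pose C0 := nrc_point c @` [set y | y != 0].
pose C1 := nrc_point d @` [set y | y != 0].
have parC : nrc_parametrization C0 c.
  apply: nrc_tuple_parametrization; first exact: geq_minl.
  exact: directrix_free.
have parD : nrc_parametrization C1 d.
  by apply: nrc_tuple_parametrization => //; apply: direction_free.
exists C0, C1, d', kappa; split=> //.
- split; first by exists c.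
  move=> _ [y /= y0 <-]; rewrite cE //.
  exists <[denominator z y *: a + (y 0%R 1%R)%:A *: h + (0 : F)%:A *: t]>%VS.
    split; last exact: surface_point_affine.
    split; last by rewrite -memvE !scale0r addr0 memvD // memvZ.
    rewrite dim_vline; have [e|//] := eqVneq _ 0.
    by have := surface_vector_affine 0 y0; rewrite e mem0v.
  by rewrite phi_surface_point // scale0r addr0.
- split; first by exists d.
  move=> _ [y /= y0 <-]; rewrite dE //; split.
    by rewrite dim_vline direction_point_neq0.
  rewrite -memvE; apply/mem_field_reduction => //.
  by exists (denominator z y)^-1.
- split; last first.
    exists c, d, 1%:M; split=> //; first exact: unitmx1.
    by move=> y y0; rewrite mulmx1 kE.
  split.
  + by move=> _ [y y0 <-]; rewrite kE //; exists y.
  + move=> _ _ /set_mem[y /= y0 <-] /set_mem[y' /= y'0 <-].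
    rewrite !kE // !cE // !dE // => /(direction_point_inj y0 y'0)[x x0 ->].
    by rewrite directrix_pointZ.
  + by move=> _ [y y0 <-]; exists (nrc_point c y); [exists y | rewrite kE].
apply/seteqP; split=> Q.
  move=> [_ [/BE[y [s [ys ->]]] Pl] <-].
  have y0 : y != 0.
    apply/eqP => y0; apply: Pl; move: ys; rewrite y0 eqxx /denominator !mxE /=.
    move=> s0; rewrite !scale0r mul0r subr0 scale0r !add0r.
    rewrite line_scale ?alg_eq0 //.
    by split; rewrite ?dim_vline ?t0 // -memvE.
  exists (nrc_point c y); first by exists y.
  rewrite kE // cE // dE // phi_surface_point //.
  by apply/surface_line_pointP => //; exists s.
move=> [_ [y /= y0 <-]]; rewrite kE // cE // dE //.
move=> /(surface_line_pointP _ y0)[s ->].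
exists <[denominator z y *: a + (y 0%R 1%R)%:A *: h + s%:A *: t]>%VS.
  split; last exact: surface_point_affine.
  by apply/BE; exists y, s; rewrite y0.
exact: phi_surface_point.
Qed.

End Surface.
End RuledSurface.
Theorem theorem4p3 (q n : nat) (F : finFieldType) (L : fieldExtType F)
    (hq : #|F| = q) (hL : \dim {: L} = n) (hn : (2 <= n)%N)
    (linf : {vspace 'rV[L]_3}) (hlinf : \dim linf = 2%N)
    (K : {vspace {ffun 'I_3 -> L}}) (hK : \dim K = (2 * n).+1)
    (hKlinf : forall P, point_set linf P -> (field_reduction P <= K)%VS)
    (B : set {vspace 'rV[L]_3}) (hB : subplane B)
    (T : {vspace 'rV[L]_3}) (hT : tangent_at B linf T)
    (b : set {vspace 'rV[L]_3}) (hb : subplane_line B b) (hbT : ~ b T)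
    (lb : {vspace 'rV[L]_3}) (hlb : \dim lb = 2%N) (hblb : b `<=` point_set lb) :
  let phi := andre_bruck_bose K in
  let Theta := (lb :&: linf)%VS in
  let m := point_degree b Theta in
  exists (C0 C1 : set {vspace {ffun 'I_3 -> L}}) (delta' : nat)
         (kappa : {vspace {ffun 'I_3 -> L}} -> {vspace {ffun 'I_3 -> L}}),
    [/\ normal_rational_curve (minn q m) C0 /\
          C0 `<=` phi @` (point_set lb `\` point_set linf),
        normal_rational_curve delta' C1 /\ C1 `<=` point_set (field_reduction T),
        (if (m < q)%N then delta' = (m - 1)%N
         else delta' = (q - 1)%N \/ delta' = q),
        nrc_projectivity (minn q m) delta' C0 C1 kappa &
        phi @` (B `\` point_set linf) = ruled_surface C0 kappa].
Proof.
move=> phi Theta m.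
have [hb1 hb2] := hb.
have [a [h [t [z [[a_lb al h_lb hl h0] [t0 tl TE] zF mE BE]]]]] :=
  adapted_frame hlinf hlb hB hT hb hbT hblb.
have hK' : \dim K = (2 * \dim {: L}).+1 by rewrite hL.
have [mu mu0 aK] := ambient_affine_chart hlinf hK' hKlinf al.
have scale_mem (U : {vspace 'rV[L]_3}) v : (mu *: v \in U) = (v \in U).
  by rewrite memvE line_scale // -memvE.
rewrite /phi {}/m {}/Theta mE TE -(line_scale t mu0) -hq.
apply: (@tangent_subplane_ruled _ _ linf lb K (mu *: a) (mu *: h) (mu *: t) z);
  rewrite ?scale_mem ?scaler_eq0 ?negb_or ?mu0 //.
have scaleE (x y s : L) : x *: (mu *: a) + y *: (mu *: h) + s *: (mu *: t) =
    mu *: (x *: a + y *: h + s *: t).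
  by rewrite !scalerDr !scalerA ![_ * mu]mulrC.
by move=> P; rewrite BE; split=> -[y [s [ys ->]]]; exists y, s;
  rewrite scaleE line_scale.
Qed.
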